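(* Let $E_{\mathrm R}$ be Read's Banach space, let $\psi\colon\mathcal{B}(E_{\mathrm R})\to\widetilde{\ell}_2$ be the Laustsen--Skillicorn quotient homomorphism onto the unitisation of $\ell_2$ endowed with zero product, so that $\ker\psi=\mathcal{W}(E_{\mathrm R})$, and put $\mathcal{I}_{\mathrm R}=\psi^{-1}[\ell_2]$, a codimension-one ideal of $\mathcal{B}(E_{\mathrm R})$. Then $E_{\mathrm R}$ has the primary factorisation property if and only if, for every $W\in\mathcal{W}(E_{\mathrm R})$, the identity on $E_{\mathrm R}$ factors through $\mathrm{Id}_{E_{\mathrm R}}-W$. If these equivalent conditions hold, then $$\mathcal{M}_{E_{\mathrm R}}=\mathcal{I}_{\mathrm R}\qquad\text{and}\qquad \mathcal{B}(E_{\mathrm R})/\mathcal{M}_{E_{\mathrm R}}\simeq\mathbb{C}.$$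
   Context: For a Banach space $E$, $\mathcal{B}(E)$ denotes the Banach algebra of bounded linear operators on $E$, $\mathrm{Id}_E$ the identity operator, and $\mathcal{W}(E)$ the ideal of weakly compact operators. The identity $\mathrm{Id}_E$ factors through $T\in\mathcal{B}(E)$ if there are $U,V\in\mathcal{B}(E)$ with $UTV=\mathrm{Id}_E$. $E$ has the primary factorisation property (PFP) if for every $T\in\mathcal{B}(E)$ the identity $\mathrm{Id}_E$ factors through $T$ or through $\mathrm{Id}_E-T$. Put $\mathcal{M}_E=\{T\in\mathcal{B}(E): \mathrm{Id}_E \text{ does not factor through } T\}$. $\widetilde{\ell}_2=\ell_2\oplus\mathbb{C}1$ is the unitisation of the complex Hilbert space $\ell_2$ equipped with the zero product, i.e. $(\xi+\lambda 1)(\eta+\mu 1)=\mu\xi+\lambda\eta+\lambda\mu 1$. $E_{\mathrm R}$ denotes the complex Banach space constructed by C. J. Read in ''Discontinuous derivations on the algebra of bounded operators on a Banach space'', J. London Math. Soc. (2) 40 (1989), 305--326. The following is due to N. J. Laustsen and R. Skillicorn (''Extensions and the weak Calkin algebra of Read's Banach space admitting discontinuous derivations'', Studia Math. 236 (2017), 51--62) and may be taken as known: there is a continuous surjective unital algebra homomorphism $\psi\colon\mathcal{B}(E_{\mathrm R})\to\widetilde{\ell}_2$ with $\ker\psi=\mathcal{W}(E_{\mathrm R})$, and the short exact sequence $0\to\mathcal{W}(E_{\mathrm R})\to\mathcal{B}(E_{\mathrm R})\xrightarrow{\psi}\widetilde{\ell}_2\to 0$ splits strongly, i.e. $\psi$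 has a right inverse that is a continuous algebra homomorphism. The ideal $\mathcal{I}_{\mathrm R}$ coincides with the codimension-one ideal of $\mathcal{B}(E_{\mathrm R})$ constructed by Read. *)

(* Defs.v *)
From HB Require Import structures.
From mathcomp Require Import all_boot all_order all_algebra.
From mathcomp Require Import generic_quotient ring_quotient.
From mathcomp Require Import all_classical all_reals all_analysis.
From mathcomp Require Import complex ring.

Set Implicit Arguments.
Unset Strict Implicit.
Unset Printing Implicit Defensive.

Import Order.TTheory GRing.Theory Num.Theory.
Import numFieldNormedType.Exports.

Local Open Scope classical_set_scope.
Local Open Scope ring_scope.

Section RealNorm.
Context {R : realType} {E : normedModType R[i]}.

(* The norm of a complex normed space takes its values in R[i]; rnorm is the
   same number as an element of R. *)
Definition rnorm (x : E) : R := complex.Re `|x|.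

Lemma rnormE x : (rnorm x)%:C%C = `|x|.
Proof. by apply: RRe_real; apply: normr_real. Qed.

Lemma rnorm_ge0 x : 0 <= rnorm x.
Proof. by rewrite -ler0c rnormE. Qed.

Lemma rnormD x y : rnorm (x + y) <= rnorm x + rnorm y.
Proof. by rewrite -lecR rmorphD /= !rnormE ler_normD. Qed.

Lemma rnormZ (a : R[i]) x : rnorm (a *: x) = complex.Re `|a| * rnorm x.
Proof.
apply: complexI; rewrite rmorphM /= !rnormE normrZ; congr (_ * _).
Qed.

Lemma rnorm0_eq0 x : rnorm x = 0 -> x = 0.
Proof. by move=> h; apply/normr0_eq0; rewrite -rnormE h. Qed.

Lemma rnorm0 : rnorm 0 = 0.
Proof. by rewrite /rnorm normr0. Qed.
End RealNorm.

Section BoundedOp.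
Context {K : numFieldType} (E F : normedModType K).

Definition bounded_linear : {pred E -> F} :=
  [pred f | `[< linear f /\ continuous f >]].

Fact bounded_linear_submod : submod_closed bounded_linear.
Proof.
split=> [|a f g /asboolP[fl fc] /asboolP[gl gc]]; apply/asboolP; split.
- by move=> b x y /=; rewrite -[LHS]/0 -[_ + _]/(b *: 0 + 0) scaler0 addr0.
- exact: cst_continuous.
- move=> b x y; rewrite !fctE fl gl !scalerDr !scalerA mulrC.
  by rewrite addrACA.
- by move=> x; apply: continuousD; [apply: continuousZr; exact: fc|exact: gc].
Qed.

HB.instance Definition _ :=
  GRing.isSubmodClosed.Build K (E -> F) bounded_linear bounded_linear_submod.

Record bounded_op := BoundedOp
  { bop_fun :> E -> F; bop_funP : bop_fun \in bounded_linear }.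

HB.instance Definition _ := [isSub of bounded_op for bop_fun].
HB.instance Definition _ := [Choice of bounded_op by <:].
HB.instance Definition _ := [SubChoice_isSubLmodule of bounded_op by <:].

Lemma bop_ext (f g : bounded_op) : f =1 g -> f = g.
Proof. by move=> fg; apply/val_inj/funext. Qed.

Lemma bop_linear (f : bounded_op) : linear f.
Proof. by have /asboolP[] := bop_funP f. Qed.

Lemma bop_continuous (f : bounded_op) : continuous f.
Proof. by have /asboolP[] := bop_funP f. Qed.

HB.instance Definition _ (f : bounded_op) :=
  GRing.isLinear.Build K E F *:%R (bop_fun f) (bop_linear f).
End BoundedOp.
Arguments bounded_linear {K} E F _.

Section OperatorRing.
Context {K : numFieldType} (E : normedModType K).

Fact bop_one_subproof : (@id E) \in bounded_linear E E.
Proof. by apply/asboolP; split=> // x; exact: cvg_id. Qed.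
Definition bop_one := BoundedOp bop_one_subproof.

Fact bop_mul_subproof (f g : bounded_op E E) : (f \o g) \in bounded_linear E E.
Proof.
apply/asboolP; split=> [a x y|x] /=; first by rewrite !linearP.
by apply: continuous_comp; exact: bop_continuous.
Qed.
Definition bop_mul f g := BoundedOp (bop_mul_subproof f g).

Fact bop_mulA : associative bop_mul. Proof. by move=> f g h; exact: bop_ext. Qed.
Fact bop_mul1 : left_id bop_one bop_mul. Proof. by move=> f; exact: bop_ext. Qed.
Fact bop_1mul : right_id bop_one bop_mul. Proof. by move=> f; exact: bop_ext. Qed.
Fact bop_mulDl : left_distributive bop_mul +%R.
Proof. by move=> f g h; exact: bop_ext. Qed.
Fact bop_mulDr : right_distributive bop_mul +%R.
Proof. by move=> f g h; apply: bop_ext => x; exact: linearD. Qed.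

HB.instance Definition _ := GRing.Zmodule_isPzRing.Build (bounded_op E E)
  bop_mulA bop_mul1 bop_1mul bop_mulDl bop_mulDr.

Lemma bop_scaleAl (a : K) (f g : bounded_op E E) : a *: (f * g) = (a *: f) * g.
Proof. exact: bop_ext. Qed.
Lemma bop_scaleAr (a : K) (f g : bounded_op E E) : a *: (f * g) = f * (a *: g).
Proof. by apply: bop_ext => x; apply/esym/linearZ. Qed.
End OperatorRing.

Definition unit_ball {K : numFieldType} (E : normedModType K) : set E :=
  [set x | `|x| <= 1].
Arguments unit_ball {K} E _.

Section OperatorNorm.
Context {R : realType} (E F : normedModType R[i]).
Implicit Types f g : bounded_op E F.

Definition bop_norm f : R := sup [set rnorm (f x) | x in unit_ball E].

Lemma bop_bounded f : exists M : R, forall x, rnorm (f x) <= M * rnorm x.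
Proof.
have /linear_bounded_continuous/linear_boundedP := @bop_continuous _ _ _ f.
move=> /pinfty_ex_gt0[M M0 fM]; exists (complex.Re M) => x.
rewrite -lecR rmorphM /= !rnormE RRe_real ?gtr0_real//; exact: fM.
Qed.

Lemma unit_ballP (x : E) : unit_ball E x <-> rnorm x <= 1.
Proof. by rewrite /unit_ball /= -rnormE (lecR _ 1). Qed.

Let has_sup_bop f : has_sup [set rnorm (f x) | x in unit_ball E].
Proof.
split; first by exists (rnorm (f 0)); exists 0 => //; apply/unit_ballP; rewrite rnorm0.
have [M fM] := bop_bounded f; exists `|M| => _ [x /unit_ballP x1 <-].
apply: (le_trans (fM x)); apply: le_trans (_ : `|M| * rnorm x <= _).
  by rewrite ler_wpM2r ?rnorm_ge0// ler_norm.
by rewrite -[leRHS]mulr1 ler_wpM2l.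
Qed.

Let bop_norm_ub f x : unit_ball E x -> rnorm (f x) <= bop_norm f.
Proof. by move=> x1; apply: ub_le_sup; [case: (has_sup_bop f)|exists x]. Qed.

Lemma bop_normP f x : rnorm (f x) <= bop_norm f * rnorm x.
Proof.
have [->|x0] := eqVneq x 0; first by rewrite linear0 !rnorm0 mulr0.
have nx0 : 0 < rnorm x.
  by rewrite lt0r rnorm_ge0 andbT; apply: contraNneq x0 => /rnorm0_eq0 ->.
have := @bop_norm_ub f (((rnorm x)^-1)%:C%C *: x).
have e : complex.Re `|((rnorm x)^-1)%:C%C| = (rnorm x)^-1.
  by rewrite ger0_norm // ler0c invr_ge0 ltW.
rewrite linearZ /= rnormZ e => h.
rewrite -ler_pdivrMr // mulrC; apply: h.
by apply/unit_ballP; rewrite rnormZ e mulVf ?gt_eqF.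
Qed.

Let bop_norm_le f M : (forall x, unit_ball E x -> rnorm (f x) <= M) -> bop_norm f <= M.
Proof.
move=> h; apply: ge_sup; first by case: (has_sup_bop f).
by move=> _ [x x1 <-]; exact: h.
Qed.

Fact bop_normD f g : (bop_norm (f + g))%:C%C <= (bop_norm f)%:C%C + (bop_norm g)%:C%C :> R[i].
Proof.
rewrite -rmorphD /= lecR; apply: bop_norm_le => x x1.
by apply: (le_trans (rnormD _ _)); apply: lerD; exact: bop_norm_ub.
Qed.

Lemma bop_norm_ge0 f : 0 <= bop_norm f.
Proof. by apply: (le_trans (rnorm_ge0 (f 0))); apply: bop_norm_ub; apply/unit_ballP; rewrite rnorm0. Qed.

Let bop_normZ_le (a : R[i]) f : bop_norm (a *: f) <= complex.Re `|a| * bop_norm f.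
Proof.
apply: bop_norm_le => x x1; rewrite -[(a *: f) x]/(a *: f x) rnormZ.
apply: ler_wpM2l; last exact: bop_norm_ub.
by rewrite -ler0c RRe_real ?normr_real.
Qed.

Fact bop_norm0_eq0 f : (bop_norm f)%:C%C = 0 :> R[i] -> f = 0.
Proof.
move=> /complexI f0; apply: bop_ext => x; apply: rnorm0_eq0; apply/le_anti.
by rewrite rnorm_ge0 andbT (le_trans (bop_normP f x))// f0 mul0r.
Qed.

Fact bop_normZ (a : R[i]) f : (bop_norm (a *: f))%:C%C = `|a| * (bop_norm f)%:C%C.
Proof.
have aE (b : R[i]) : (complex.Re `|b|)%:C%C = `|b| by rewrite RRe_real ?normr_real.
rewrite -[`|a|]aE -rmorphM; congr (_%:C)%C.
apply/le_anti; rewrite bop_normZ_le andTb.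
have [->|a0] := eqVneq a 0; first by rewrite normr0 mul0r bop_norm_ge0.
have na0 : 0 < complex.Re `|a| by rewrite -(@ltcR R 0) aE normr_gt0.
rewrite -ler_pdivlMl // -{1}[f](scalerK a0) (le_trans (bop_normZ_le _ _))//.
rewrite le_eqVlt; apply/orP; left; apply/eqP; congr (_ * _).
by apply: complexI; rewrite aE rmorphV ?unitfE ?gt_eqF //= aE normfV.
Qed.

HB.instance Definition _ := Lmodule_isNormed.Build R[i] (bounded_op E F)
  bop_normD bop_normZ bop_norm0_eq0.
End OperatorNorm.

Section SquareSummable.
Context (R : realType).

Definition abs_sq (x : nat -> R[i]) : R^nat := fun n => (complex.Re `|x n|) ^+ 2.

Definition square_summable : {pred nat -> R[i]} :=
  [pred x | `[< cvgn (series (abs_sq x)) >]].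

Let cabs (a : R[i]) : (complex.Re `|a|)%:C%C = `|a|.
Proof. by rewrite RRe_real ?normr_real. Qed.

Let cabs_ge0 (a : R[i]) : 0 <= complex.Re `|a|.
Proof. by rewrite -ler0c cabs. Qed.

Let cabsD (a b : R[i]) : complex.Re `|a + b| <= complex.Re `|a| + complex.Re `|b|.
Proof. by rewrite -lecR rmorphD /= !cabs ler_normD. Qed.

Let cabsM (a b : R[i]) : complex.Re `|a * b| = complex.Re `|a| * complex.Re `|b|.
Proof. by apply: complexI; rewrite rmorphM /= !cabs normrM. Qed.

Let abs_sq_ge0 x n : 0 <= abs_sq x n. Proof. exact: sqr_ge0. Qed.

Let abs_sqZ a x : abs_sq (a *: x) = (complex.Re `|a|) ^+ 2 *: abs_sq x.
Proof. by apply/funext => n; rewrite /abs_sq -[(a *: x) n]/(a * x n) cabsM exprMn. Qed.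

Let abs_sq0 : abs_sq 0 = 0.
Proof. by apply/funext => n; change (complex.Re `|0 : R[i]| ^+ 2 = 0 :> R); rewrite normr0 expr0n. Qed.

Let le_abs_sq2 x y n : abs_sq (x + y) n <= 2 * abs_sq x n + 2 * abs_sq y n.
Proof.
rewrite /abs_sq -[(x + y) n]/(x n + y n).
set a := complex.Re `|x n|; set b := complex.Re `|y n|.
apply: (@le_trans _ _ ((a + b) ^+ 2)).
  by rewrite ler_sqr ?nnegrE ?addr_ge0 ?cabs_ge0 // cabsD.
by rewrite -subr_ge0 (_ : _ - _ = (a - b) ^+ 2) ?sqr_ge0 //; ring.
Qed.

Fact square_summable_submod : submod_closed square_summable.
Proof.
have sD x y : x \in square_summable -> y \in square_summable -> x + y \in square_summable.
  move=> /asboolP xs /asboolP ys; apply/asboolP.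
  apply: (@series_le_cvg _ _ (2 *: abs_sq x + 2 *: abs_sq y)) => [n|n|n|].
  - exact: abs_sq_ge0.
  - by apply: addr_ge0; apply: mulr_ge0 => //; exact: abs_sq_ge0.
  - exact: le_abs_sq2.
  - by rewrite seriesD !seriesZ; apply: is_cvgD; apply: is_cvgZr.
have sZ a x : x \in square_summable -> a *: x \in square_summable.
  by move=> /asboolP xs; apply/asboolP; rewrite abs_sqZ seriesZ; apply: is_cvgZr.
split=> [|a x y xs ys]; last by rewrite sD ?sZ.
apply/asboolP; rewrite abs_sq0 (_ : series 0 = cst 0); first exact: is_cvg_cst.
by apply/funext => n; rewrite /series /= big1.
Qed.

HB.instance Definition _ := GRing.isSubmodClosed.Build R[i] (nat -> R[i])
  square_summable square_summable_submod.

Record l2 := L2 { l2_fun :> nat -> R[i]; l2_funP : l2_fun \in square_summable }.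

HB.instance Definition _ := [isSub of l2 for l2_fun].
HB.instance Definition _ := [Choice of l2 by <:].
HB.instance Definition _ := [SubChoice_isSubLmodule of l2 by <:].

Definition l2_norm (x : l2) : R := Num.sqrt (limn (series (abs_sq x))).

Let l2_cvg (x : l2) : cvgn (series (abs_sq x)).
Proof. by have /asboolP := l2_funP x. Qed.

Let lim_abs_sq_ge0 (x : l2) : 0 <= limn (series (abs_sq x)).
Proof.
apply: limr_ge; first exact: l2_cvg.
by apply: nearW => n; rewrite /series /= sumr_ge0.
Qed.

Let l2_norm_sq (x : l2) : l2_norm x ^+ 2 = limn (series (abs_sq x)).
Proof. exact: sqr_sqrtr. Qed.

Let l2_norm_eq0 (x : l2) : l2_norm x = 0 -> x = 0.
Proof.
move=> x0; have := l2_norm_sq x; rewrite x0 expr0n => /esym lim0.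
apply/val_inj/funext => n /=; apply/normr0_eq0; rewrite -cabs.
suff : abs_sq x n = 0 by move=> /eqP; rewrite sqrf_eq0 => /eqP ->.
apply/le_anti; rewrite abs_sq_ge0 andbT -[leRHS]lim0.
apply: (@le_trans _ _ (series (abs_sq x) n.+1)).
  by rewrite seriesS lerDl /series /= sumr_ge0.
apply: nondecreasing_cvgn_le; last exact: l2_cvg.
by apply/nondecreasing_seqP => k; rewrite seriesS lerDr.
Qed.

Let l2_norm0 : l2_norm 0 = 0.
Proof.
rewrite /l2_norm (_ : abs_sq _ = 0); last exact: abs_sq0.
rewrite (_ : series 0 = cst 0) ?lim_cst ?sqrtr0 //.
by apply/funext => n; rewrite /series /= big1.
Qed.

Let l2_norm_ge0 x : 0 <= l2_norm x. Proof. exact: sqrtr_ge0. Qed.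

Let l2_normD' (x y : l2) : l2_norm (x + y) <= l2_norm x + l2_norm y.
Proof.
have [x0|x0] := eqVneq (l2_norm x) 0.
  by rewrite (l2_norm_eq0 x0) add0r l2_norm0 add0r.
have [y0|y0] := eqVneq (l2_norm y) 0.
  by rewrite (l2_norm_eq0 y0) addr0 l2_norm0 addr0.
set A := l2_norm x in x0 *; set B := l2_norm y in y0 *.
have A0 : 0 < A by rewrite lt0r x0 l2_norm_ge0.
have B0 : 0 < B by rewrite lt0r y0 l2_norm_ge0.
have AB0 : 0 <= A + B by rewrite addr_ge0 // ltW.
rewrite -[leRHS](ger0_norm AB0) -sqrtr_sqr ler_sqrt ?sqr_ge0 //.
pose c := (A + B) / A; pose d := (A + B) / B.
have c0 : 0 <= c by rewrite divr_ge0 // ltW.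
have d0 : 0 <= d by rewrite divr_ge0 // ltW.
have -> : (A + B) ^+ 2 = limn (series (c *: abs_sq x + d *: abs_sq y)).
  rewrite lim_seriesD; [|rewrite seriesZ; apply: is_cvgZr; exact: l2_cvg..].
  rewrite !lim_seriesZ; [|exact: l2_cvg..].
  by rewrite -!l2_norm_sq -/A -/B /c /d /GRing.scale /=; field; rewrite ?x0 ?y0.
apply: lim_series_le; first exact: l2_cvg.
  by rewrite seriesD !seriesZ; apply: is_cvgD; apply: is_cvgZr; exact: l2_cvg.
move=> n; change (abs_sq (x + y) n <= c * abs_sq x n + d * abs_sq y n).
rewrite /abs_sq.
set a := complex.Re `|x n|; set b := complex.Re `|y n|.
apply: (@le_trans _ _ ((a + b) ^+ 2)).
  change (complex.Re `|x n + y n| ^+ 2 <= (a + b) ^+ 2).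
  by rewrite ler_sqr ?nnegrE ?addr_ge0 ?cabs_ge0 // cabsD.
rewrite -subr_ge0.
have -> : c * a ^+ 2 + d * b ^+ 2 - (a + b) ^+ 2 = (B * a - A * b) ^+ 2 / (A * B).
  by rewrite /c /d; field; rewrite ?x0 ?y0.
by rewrite divr_ge0 ?sqr_ge0 // mulr_ge0 // ltW.
Qed.

Fact l2_normD (x y : l2) :
  (l2_norm (x + y))%:C%C <= (l2_norm x)%:C%C + (l2_norm y)%:C%C :> R[i].
Proof. by rewrite -rmorphD /= lecR l2_normD'. Qed.

Fact l2_normZ (a : R[i]) (x : l2) :
  (l2_norm (a *: x))%:C%C = `|a| * (l2_norm x)%:C%C.
Proof.
rewrite -cabs -rmorphM; congr (_%:C)%C.
rewrite /l2_norm (_ : abs_sq _ = (complex.Re `|a|) ^+ 2 *: abs_sq x); last exact: abs_sqZ.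
rewrite lim_seriesZ; last exact: l2_cvg.
by rewrite -[_ *: _]/(_ * _) sqrtrM ?sqr_ge0 // sqrtr_sqr ger0_norm.
Qed.

Fact l2_norm0_eq0 (x : l2) : (l2_norm x)%:C%C = 0 :> R[i] -> x = 0.
Proof. by move=> /complexI /l2_norm_eq0. Qed.

HB.instance Definition _ := Lmodule_isNormed.Build R[i] l2
  l2_normD l2_normZ l2_norm0_eq0.
End SquareSummable.

(* The unitisation V + K1 of V equipped with the zero product. Its topology is
   the product topology, i.e. that of the norm |v| + |a|. *)
Definition unitisation0 {K : numFieldType} (V : normedModType K) : Type :=
  (V * K^o)%type.

Section Unitisation0.
Context {K : numFieldType} (V : normedModType K).
Local Notation U := (unitisation0 V).

HB.instance Definition _ := NormedModule.copy U (V * K^o)%type.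

Definition unit0_one : U := (0, 1).
Definition unit0_mul (x y : U) : U := (y.2 *: x.1 + x.2 *: y.1, x.2 * y.2).

Fact unit0_mulA : associative unit0_mul.
Proof.
move=> [x a] [y b] [z c]; congr pair => /=; last by rewrite mulrA.
rewrite !scalerDr !scalerA addrA; congr (_ *: _ + _ *: _ + _).
- by rewrite mulrC.
- by rewrite mulrC.
Qed.

Fact unit0_mul1 : left_id unit0_one unit0_mul.
Proof.
by move=> [x a]; congr pair; rewrite /= ?mul1r // scaler0 add0r scale1r.
Qed.

Fact unit0_1mul : right_id unit0_one unit0_mul.
Proof.
by move=> [x a]; congr pair; rewrite /= ?mulr1 // scaler0 addr0 scale1r.
Qed.

Fact unit0_mulDl : left_distributive unit0_mul +%R.
Proof.
move=> [x a] [y b] [z c]; congr pair => /=; last by rewrite mulrDl.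
by rewrite scalerDr scalerDl addrACA.
Qed.

Fact unit0_mulDr : right_distributive unit0_mul +%R.
Proof.
move=> [x a] [y b] [z c]; congr pair => /=; last by rewrite mulrDr.
by rewrite scalerDr scalerDl addrACA.
Qed.

HB.instance Definition _ := GRing.Zmodule_isPzRing.Build U
  unit0_mulA unit0_mul1 unit0_1mul unit0_mulDl unit0_mulDr.
End Unitisation0.

Section IdealQuotient.
Context {K : numFieldType} {E : normedModType K}.
Local Notation B := (bounded_op E E).

Record two_sided_ideal (I : set B) : Prop := TwoSidedIdeal {
  ideal0 : I 0;
  idealD : forall S T, I S -> I T -> I (S + T);
  idealZ : forall (a : K) T, I T -> I (a *: T);
  idealMl : forall S T, I T -> I (S * T);
  idealMr : forall S T, I T -> I (T * S) }.

Context (I : set B) (hI : two_sided_ideal I).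

Fact ideal_zmod_closed : zmod_closed (fun T => `[< I T >]).
Proof.
split=> [|S T /asboolP IS /asboolP IT]; apply/asboolP; first exact: ideal0 hI.
by apply: idealD => //; rewrite -scaleN1r; exact: idealZ.
Qed.

Definition ideal_zmod : zmodClosed B :=
  HB.pack (fun T : B => `[< I T >]) (GRing.isZmodClosed.Build B _ ideal_zmod_closed).

Definition ideal_quot : Type := Quotient.quot ideal_zmod.

HB.instance Definition _ := GRing.Zmodule.on ideal_quot.
HB.instance Definition _ := EqQuotient.on ideal_quot.

Local Open Scope quotient_scope.
Local Notation Q := ideal_quot.

Lemma ideal_quot_eqP (S T : B) : \pi_Q S = \pi_Q T <-> I (S - T).
Proof.
split=> [/eqP|h].
  by rewrite -[_ == _]/(S == T %[mod Quotient.quot ideal_zmod]) -Quotient.idealrBE => /asboolP.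
by apply/eqP; rewrite -[_ == _]/(S == T %[mod Quotient.quot ideal_zmod]) -Quotient.idealrBE; apply/asboolP.
Qed.

Lemma pi_idealD (S T : B) : \pi_Q (S + T) = \pi_Q S + \pi_Q T.
Proof. exact: (Quotient.pi_add ideal_zmod). Qed.

Definition ideal_quot_one : Q := \pi_Q 1.
Definition ideal_quot_mul (x y : Q) : Q := \pi_Q (repr x * repr y).
Definition ideal_quot_scale (a : K) (x : Q) : Q := \pi_Q (a *: repr x).

Let reprP (S : B) : I (repr (\pi_Q S) - S).
Proof. by apply/ideal_quot_eqP; rewrite reprK. Qed.

Lemma pi_idealM (S T : B) : ideal_quot_mul (\pi_Q S) (\pi_Q T) = \pi_Q (S * T).
Proof.
apply/ideal_quot_eqP; set S' := repr _; set T' := repr _.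
have -> : S' * T' - S * T = S' * (T' - T) + (S' - S) * T.
  by rewrite mulrBr mulrBl addrA subrK.
by apply: (idealD hI); [apply: (idealMl hI)|apply: (idealMr hI)]; exact: reprP.
Qed.

Lemma pi_idealZ (a : K) (S : B) : ideal_quot_scale a (\pi_Q S) = \pi_Q (a *: S).
Proof.
by apply/ideal_quot_eqP; rewrite -scalerBr; apply: (idealZ hI); exact: reprP.
Qed.

Fact ideal_quot_mulA : associative ideal_quot_mul.
Proof.
elim/quotW => S; elim/quotW => T; elim/quotW => V.
by rewrite (pi_idealM T V) (pi_idealM S T) pi_idealM pi_idealM mulrA.
Qed.

Fact ideal_quot_mul1 : left_id ideal_quot_one ideal_quot_mul.
Proof. by elim/quotW => S; rewrite pi_idealM mul1r. Qed.

Fact ideal_quot_1mul : right_id ideal_quot_one ideal_quot_mul.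
Proof. by elim/quotW => S; rewrite pi_idealM mulr1. Qed.

Fact ideal_quot_mulDl : left_distributive ideal_quot_mul +%R.
Proof.
elim/quotW => S; elim/quotW => T; elim/quotW => V.
by rewrite (pi_idealM S V) (pi_idealM T V) -(pi_idealD S T) -pi_idealD pi_idealM mulrDl.
Qed.

Fact ideal_quot_mulDr : right_distributive ideal_quot_mul +%R.
Proof.
elim/quotW => S; elim/quotW => T; elim/quotW => V.
by rewrite (pi_idealM S T) (pi_idealM S V) -(pi_idealD T V) -pi_idealD pi_idealM mulrDr.
Qed.

HB.instance Definition _ := GRing.Zmodule_isPzRing.Build ideal_quot
  ideal_quot_mulA ideal_quot_mul1 ideal_quot_1mul
  ideal_quot_mulDl ideal_quot_mulDr.

Fact ideal_quot_scaleA a b (x : Q) :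
  ideal_quot_scale a (ideal_quot_scale b x) = ideal_quot_scale (a * b) x.
Proof. by elim/quotW: x => S; rewrite (pi_idealZ b S) pi_idealZ pi_idealZ scalerA. Qed.

Fact ideal_quot_scale1 : left_id 1 ideal_quot_scale.
Proof. by elim/quotW => S; rewrite pi_idealZ scale1r. Qed.

Fact ideal_quot_scaleDr : right_distributive ideal_quot_scale +%R.
Proof.
move=> a; elim/quotW => S; elim/quotW => T.
by rewrite (pi_idealZ a S) (pi_idealZ a T) -!pi_idealD pi_idealZ scalerDr.
Qed.

Fact ideal_quot_scaleDl (x : Q) :
  {morph ideal_quot_scale^~ x : a b / a + b}.
Proof.
elim/quotW: x => S a b.
by rewrite (pi_idealZ a S) (pi_idealZ b S) -pi_idealD pi_idealZ scalerDl.
Qed.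

HB.instance Definition _ := GRing.Zmodule_isLmodule.Build K ideal_quot
  ideal_quot_scaleA ideal_quot_scale1 ideal_quot_scaleDr ideal_quot_scaleDl.
End IdealQuotient.

Section WeakTopology.
Context {K : numFieldType} (E : normedModType K).

Definition dual_eval (x : E) : {ptws bounded_op E K^o -> K^o} :=
  fun phi => phi x.

(* E with its weak topology, the coarsest one making every continuous linear
   functional continuous. *)
Definition weak_space : Type := initial_topology dual_eval.

HB.instance Definition _ := Topological.copy weak_space (initial_topology dual_eval).
End WeakTopology.

Section Factorisation.
Context {K : numFieldType} (E : normedModType K).
Local Notation B := (bounded_op E E).

Definition weakly_compact : set B :=
  [set T | compact (closure (T @` unit_ball E : set (weak_space E)))].

Definition id_factors_through (T : B) : Prop := exists U V : B, U * T * V = 1.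

Definition primary_factorisation_property : Prop :=
  forall T : B, id_factors_through T \/ id_factors_through (1 - T).

Definition nonfactoring : set B := [set T | ~ id_factors_through T].
End Factorisation.
Arguments weakly_compact {K} E _.
Arguments nonfactoring {K} E _.

(* Isomorphism of Banach algebras between B(E)/I and the scalars. For a closed
   ideal I, the topology given by the quotient norm is the quotient topology. *)
Definition quotient_isomorphic_scalars (R : realType) (E : normedModType R[i])
    (I : set (bounded_op E E)) (hI : two_sided_ideal I) : Prop :=
  exists (f : ideal_quot hI -> R[i]^o) (g : R[i]^o -> ideal_quot hI),
    [/\ linear f, monoid_morphism f, cancel f g & cancel g f] /\
    continuous (f : quotient_topology (ideal_quot hI) -> R[i]^o) /\
    continuous (g : R[i]^o -> quotient_topology (ideal_quot hI)).

Section ReadQuotient.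
Context {R : realType} {E : completeNormedModType R[i]}.
Local Notation B := (bounded_op E E).
Local Notation U := (unitisation0 (l2 R)).
Implicit Type psi : B -> U.

(* The strongly split extension 0 -> W(E) -> B(E) -> U -> 0 that Laustsen and
   Skillicorn obtained for Read's Banach space. That space is not constructed
   here: a pair (E, psi) with this property stands for it. The right inverse
   theta is not required to be unital. *)
Record laustsen_skillicorn_quotient psi : Prop := LaustsenSkillicornQuotient {
  ls_linear : linear psi;
  ls_monoid_morphism : monoid_morphism psi;
  ls_continuous : continuous psi;
  ls_surjective : forall u, exists T, psi T = u;
  ls_kernel : psi @^-1` [set 0] = weakly_compact E;
  ls_split : exists theta : U -> B,
    [/\ linear theta, {morph theta : u v / u * v}, continuous theta
      & cancel theta psi] }.

Definition read_ideal psi : set B :=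
  psi @^-1` range (fun xi : l2 R => (xi, 0) : U).

Lemma read_idealE psi T : read_ideal psi T <-> (psi T).2 = 0.
Proof.
by split=> [[xi _ <-]//|p0]; exists (psi T).1 => //; case: (psi T) p0 => xi a /= ->.
Qed.

Lemma read_ideal_two_sided psi :
  laustsen_skillicorn_quotient psi -> two_sided_ideal (read_ideal psi).
Proof.
move=> [lin [psi1 psiM] _ _ _ _].
have psiD S T : psi (S + T) = psi S + psi T by rewrite -[S]scale1r lin !scale1r.
have psi0 : psi 0 = 0 by apply: (addrI (psi 0)); rewrite -psiD !addr0.
have psiZ a T : psi (a *: T) = a *: psi T by rewrite -[a *: T]addr0 lin psi0 addr0.
split=> [|S T|a T|S T|S T]; rewrite !read_idealE.
- by rewrite psi0.
- by rewrite psiD => /= -> ->; rewrite addr0.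
- by rewrite psiZ => /= ->; rewrite scaler0.
- by rewrite psiM => /= ->; rewrite mulr0.
- by rewrite psiM => /= ->; rewrite mul0r.
Qed.

Lemma read_ideal_codim1 psi : laustsen_skillicorn_quotient psi ->
  ~ read_ideal psi 1 /\
  forall T : B, exists a : R[i], read_ideal psi (T - a *: (1 : B)).
Proof.
move=> [lin [psi1 psiM] _ _ _ _]; split.
  by rewrite read_idealE psi1 => /eqP; rewrite oner_eq0.
move=> T; exists (psi T).2; apply/read_idealE.
rewrite addrC -scaleNr lin psi1 /= -[_ *: _]/(_ * _).
by rewrite mulr1 addrC subrr.
Qed.
End ReadQuotient.

(* Main.v *)
(* The second component of [psi T] decides factorisation. If it vanishes, so does
   that of [psi (U * T * V)], which is therefore not [1]. If it does not vanish,
   [psi T] is invertible in the unitisation; lifting its inverse to [S] gives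
   [1 - S * T] in the kernel of [psi], i.e. weakly compact, so by hypothesis the
   identity factors through [S * T]. One of [T] and [1 - T] is always of the
   second kind. *)
Require Import Defs.
From mathcomp Require Import all_boot all_order all_algebra.
From mathcomp Require Import all_classical all_reals all_analysis.
From mathcomp Require Import complex.

Import Order.TTheory GRing.Theory Num.Theory.
Import numFieldNormedType.Exports.

Local Open Scope classical_set_scope.
Local Open Scope ring_scope.

(** Since [x] squares to zero, the geometric series for the inverse of [a (1 + x / a)] stops after
    its linear term, leaving [1 / a - x / a ^ 2]. *)
Lemma unit0_mulVl (K : numFieldType) (V : normedModType K) (x : V) (a : K) :
  a != 0 ->
  ((- (a ^- 2 *: x), a^-1) : unitisation0 V) * ((x, a) : unitisation0 V) = 1.
Proof.
move=> a0; congr pair => /=; last by rewrite mulVf.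
by rewrite scalerN scalerA -exprVn expr2 mulrA mulfV // mul1r addNr.
Qed.

Lemma id_factors_through_mull (K : numFieldType) (E : normedModType K)
    (S T : bounded_op E E) : id_factors_through (S * T) -> id_factors_through T.
Proof. by move=> [U [V UV]]; exists (U * S), V; rewrite -(mulrA U). Qed.

Section ReadQuotient.
Context {R : realType} {E : completeNormedModType R[i]}.
Local Notation B := (bounded_op E E).
Context {psi : B -> unitisation0 (l2 R)}.
Context (hpsi : laustsen_skillicorn_quotient psi).

Lemma ls_sub S T : psi (S - T) = psi S - psi T.
Proof. by rewrite addrC -scaleN1r (ls_linear hpsi) scaleN1r addrC. Qed.

Lemma ls_sub1 T : psi (1 - T) = 1 - psi T.
Proof. by have [psi1 _] := ls_monoid_morphism hpsi; rewrite ls_sub psi1. Qed.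

Lemma read_ideal_nonfactoring T : read_ideal psi T -> ~ id_factors_through T.
Proof.
move=> /read_idealE T0 [U [V UTV]].
have [psi1 psiM] := ls_monoid_morphism hpsi.
have := congr1 snd (congr1 psi UTV).
by rewrite !psiM psi1 /= T0 mulr0 mul0r => /eqP; rewrite eq_sym oner_eq0.
Qed.

Lemma weakly_compactE W : weakly_compact E W <-> psi W = 0.
Proof. by rewrite -(ls_kernel hpsi). Qed.

Lemma notin_read_ideal_factors T :
  (forall W, weakly_compact E W -> id_factors_through (1 - W)) ->
  ~ read_ideal psi T -> id_factors_through T.
Proof.
have [_ psiM] := ls_monoid_morphism hpsi.
rewrite read_idealE => factW /eqP; case psiT: (psi T) => [x a] /= a0.
have [S psiS] := ls_surjective hpsi (- (a ^- 2 *: x), a^-1).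
apply: (@id_factors_through_mull _ _ S).
(* The weakly compact operator fed to the hypothesis is [W = 1 - S * T], so that [1 - W] is
   [S * T]. *)
rewrite -[S * T](subKr 1); apply: factW; apply/weakly_compactE.
by rewrite ls_sub1 psiM psiS psiT unit0_mulVl // subrr.
Qed.

Lemma pfp_weakly_compact : primary_factorisation_property E <->
  forall W, weakly_compact E W -> id_factors_through (1 - W).
Proof.
split=> [pfp W /weakly_compactE W0|factW T].
  (* The kernel of [psi] lies in the Read ideal, which excludes factorisation through [W] itself. *)
  have [WF|//] := pfp W; exfalso; apply: read_ideal_nonfactoring WF.
  by apply/read_idealE; rewrite W0.
have [T0|] := pselect (read_ideal psi T); last first.
  by left; exact: notin_read_ideal_factors.
right; apply: notin_read_ideal_factors => //.
move: T0; rewrite !read_idealE ls_sub1 /= => ->.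
by rewrite subr0 => /eqP; rewrite oner_eq0.
Qed.

Lemma pfp_nonfactoring : primary_factorisation_property E ->
  nonfactoring E = read_ideal psi.
Proof.
move=> /pfp_weakly_compact factW; apply/seteqP; split=> T.
  by apply: contra_notP => /(notin_read_ideal_factors _ factW).
exact: read_ideal_nonfactoring.
Qed.

Local Open Scope quotient_scope.

(** The isomorphism is induced by the character taking [T] to [(psi T).2], whose kernel is the
    ideal; its inverse sends a scalar to the class of that multiple of the identity. *)
Lemma read_ideal_quotient (hI : two_sided_ideal (read_ideal psi)) :
  quotient_isomorphic_scalars hI.
Proof.
have [psi1 psiM] := ls_monoid_morphism hpsi.
have psiL := ls_linear hpsi.
set Q := ideal_quot hI.
pose f (q : Q) : R[i]^o := (psi (repr q)).2.
pose g (a : R[i]^o) : Q := \pi_Q (a *: (1 : B)).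
(* The value of [f] does not depend on the representative chosen by [repr]: two of them differ by an
   element of the ideal. *)
have f_pi T : f (\pi_Q T) = (psi T).2.
  have /ideal_quot_eqP/read_idealE : \pi_Q (repr (\pi_Q T)) = \pi_Q T by rewrite reprK.
  by rewrite ls_sub /= => /eqP; rewrite subr_eq0 => /eqP.
have psi_scale1 (a : R[i]) : (psi (a *: (1 : B))).2 = a.
  have -> : a *: (1 : B) = a *: (1 : B) + 0 by rewrite addr0.
  have psi0 : psi 0 = 0 by rewrite -(subrr (1 : B)) ls_sub subrr.
  by rewrite psiL psi0 psi1 /= addr0 -[LHS]/(a * 1) mulr1.
exists f, g; split; first split.
- move=> a; elim/quotW => S; elim/quotW => T.
  rewrite -[a *: _]/(ideal_quot_scale a _) pi_idealZ -pi_idealD !f_pi.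
  by rewrite psiL.
- split; first by rewrite -[1]/(\pi_Q 1) f_pi psi1.
  elim/quotW => S; elim/quotW => T.
  by rewrite -[_ * _]/(ideal_quot_mul _ _) pi_idealM !f_pi psiM.
- elim/quotW => T; rewrite f_pi; apply/ideal_quot_eqP/read_idealE.
  by rewrite ls_sub /= psi_scale1 subrr.
- by move=> a; rewrite f_pi psi_scale1.
split.
(* By the universal property of the quotient topology, only the character on operators has to be
   continuous. *)
- apply/quotient_continuous.
  rewrite (_ : _ \o _ = snd \o psi); last exact/funext.
  by move=> T; apply: continuous_comp; [exact: ls_continuous|exact: cvg_snd].
- move=> a; have := @scalel_continuous _ B 1 a.
  move=> /continuous_comp; apply; exact: pi_continuous.
Qed.
End ReadQuotient.

Theorem proposition6p10 (R : realType) (E_R : completeNormedModType R[i])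
    (psi : bounded_op E_R E_R -> unitisation0 (l2 R))
    (hpsi : laustsen_skillicorn_quotient psi) :
  (primary_factorisation_property E_R <->
     forall W : bounded_op E_R E_R, weakly_compact E_R W ->
       id_factors_through (1 - W)) /\
  (primary_factorisation_property E_R ->
     nonfactoring E_R = read_ideal psi /\
     exists hM : two_sided_ideal (nonfactoring E_R),
       quotient_isomorphic_scalars hM).
Proof.
split; first exact: pfp_weakly_compact hpsi.
(* That the nonfactoring operators form an ideal, closure under sums included, is inherited from the
   Read ideal through this equality. *)
move=> /(pfp_nonfactoring hpsi) ->; split=> //.
by exists (read_ideal_two_sided hpsi); exact: read_ideal_quotient.
Qed.
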